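(* Let $m$ be a positive odd integer. Then $$\sum_{k=1}^\infty \sum_{j=0}^{k-1} \frac{(-1)^{j+k+1}}{(2j+1)^m k} = m\, \mathrm{L}(\chi_{-4}, m+1) + \sum_{h=1}^{\frac{m-1}{2}} \frac{(-1)^h \pi^{2h}(2^{2h}-1)}{(2h)!}\, B_{2h}\, \mathrm{L}(\chi_{-4}, m-2h+1),$$ where the sum over $h$ is empty (equal to $0$) when $m=1$.
   Context: $\mathrm{L}(\chi_{-4}, s) = \sum_{n=1}^\infty \frac{\chi_{-4}(n)}{n^s}$ is the Dirichlet L-series of the odd character $\chi_{-4}$ of conductor $4$, so that for a positive integer $s$, $\mathrm{L}(\chi_{-4},s) = \sum_{j=0}^\infty \frac{(-1)^j}{(2j+1)^s}$. The $B_n$ are the Bernoulli numbers, given by $\frac{t}{e^t-1} = \sum_{n=0}^\infty \frac{B_n t^n}{n!}$. The double series on the left converges only conditionally; the finite sum over $j$ is performed first, and then the outer sum is taken as the limit of its partial sums in $k$. *)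

(* Defs.v *)
From Stdlib Require Import Reals Arith.
From Coquelicot Require Import Coquelicot.
Open Scope R_scope.

Definition chi_m4 (n : nat) : R :=
  match (n mod 4)%nat with
  | 1%nat => 1
  | 3%nat => -1
  | _ => 0
  end.

(* [Series] is indexed from 0, hence the shift [n = i + 1]. Only natural
   arguments are covered; for [s = 0] the series diverges and the value is
   meaningless. *)
Definition L_chi_m4 (s : nat) : R :=
  Series (fun i : nat => chi_m4 (S i) / INR (S i) ^ s).

(* The point [t = 0] is excluded because [t / (exp t - 1)] is [0 / 0] there;
   the coefficients are determined by the punctured neighbourhood, so at most
   one [B] satisfies this. The convention is [B 1 = - 1 / 2]. *)
Definition is_bernoulli (B : nat -> R) : Prop :=
  exists r : R, 0 < r /\
    forall t : R, 0 < Rabs t < r ->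
      is_pseries (fun n : nat => B n / INR (fact n)) t (t / (exp t - 1)).

(* Main.v *)
Require Import Defs.
From Stdlib Require Import Reals Arith Lra Lia.
From Coquelicot Require Import Coquelicot.
Open Scope R_scope.

(** Write [n = 2j+1], [r = 2i+1], [m = 2p+1]. Exchanging the order of the two sums
    turns the partial sum of index [K] into a sum over [j < K] of [chi n / n^m] times
    a segment of the alternating harmonic series; up to a vanishing error this is the
    sum over the square [i, j < K] of
    [chi r / n^m * (1 / (n + r) + 1 / (n - r))]. The partial fraction identity
    [n^-m (1/(n+r) + 1/(n-r)) + 2 sum_(h=1..p) n^(-2h) r^(-(m+1-2h))
       = r^-m (1/(n-r) - 1/(n+r))]  for [n <> r]
    then separates the variables: the right-hand side telescopes in [n] and vanishes in
    the limit, the terms [n = r] contribute [m L(m+1)], and the products give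
    [-2 sum_h lambda(2h) L(m+1-2h)] with [lambda(q) = sum over odd n of n^-q].

    The same identity summed without [chi] gives
    [(2p+1) lambda(2p+2) = 2 sum_(h=1..p) lambda(2h) lambda(2p+2-2h)], and
    [lambda(2) = pi^2/8] follows from Leibniz's series by a similar square summation.
    Up to normalisation this is the recursion [y' = (1 - y^2)/2] of the Taylor
    coefficients of [y t = tanh (t/2) = 1 - 2/(e^t + 1)], which are Bernoulli numbers
    times [2 (2^n - 1) / n!]. *)

(** * Finite sums and partial fractions *)

Lemma sum_f_R0_swap (f : nat -> nat -> R) (M N : nat) :
  sum_f_R0 (fun i => sum_f_R0 (fun j => f i j) N) M =
  sum_f_R0 (fun j => sum_f_R0 (fun i => f i j) M) N.
Proof.
  induction M as [|M IH]; simpl; [reflexivity|].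
  rewrite IH, <- sum_plus; reflexivity.
Qed.

Lemma sum_f_R0_mult_l (c : R) (f : nat -> R) (N : nat) :
  sum_f_R0 (fun i => c * f i) N = c * sum_f_R0 f N.
Proof. rewrite scal_sum; apply sum_eq; intros; ring. Qed.

Lemma sum_f_R0_kronecker (f : nat -> R) (j N : nat) :
  sum_f_R0 (fun i => if Nat.eqb i j then f i else 0) N =
  if Nat.leb j N then f j else 0.
Proof.
  induction N as [|N IH].
  - destruct j; reflexivity.
  - rewrite tech5, IH. destruct (Nat.leb_spec j N), (Nat.leb_spec j (S N)), (Nat.eqb_spec (S N) j);
    subst; try lia; ring.
Qed.

Definition sum1 (f : nat -> R) (p : nat) : R := sum_n_m f 1 p.

Lemma sum1_S (f : nat -> R) (p : nat) :
  sum1 f (S p) = sum1 f p + f (S p).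
Proof. unfold sum1. now rewrite sum_n_Sm by lia. Qed.

Lemma sum1_0 (f : nat -> R) : sum1 f 0 = 0.
Proof. unfold sum1. now rewrite sum_n_m_zero by lia. Qed.

Lemma sum1_mult_l (c : R) (f : nat -> R) (p : nat) :
  sum1 (fun h => c * f h) p = c * sum1 f p.
Proof.
  induction p as [|p IH]; [rewrite !sum1_0 | rewrite !sum1_S, IH]; ring.
Qed.

Lemma sum1_ext (f g : nat -> R) (p : nat) :
  (forall h, (1 <= h <= p)%nat -> f h = g h) -> sum1 f p = sum1 g p.
Proof. intros H; apply sum_n_m_ext_loc; exact H. Qed.

Lemma sum1_swap (f : nat -> nat -> R) (p N : nat) :
  sum1 (fun h => sum_f_R0 (f h) N) p =
  sum_f_R0 (fun i => sum1 (fun h => f h i) p) N.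
Proof.
  induction p as [|p IH].
  - rewrite sum1_0, (sum_eq _ (fun _ => 0)), sum_cte; [ring|].
    intros; apply sum1_0.
  - rewrite sum1_S, IH, <- sum_plus. apply sum_eq; intros.
    now rewrite sum1_S.
Qed.

Lemma is_lim_seq_sum1 (u : nat -> nat -> R) (l : nat -> R) (p : nat) :
  (forall h, (1 <= h <= p)%nat -> is_lim_seq (u h) (l h)) ->
  is_lim_seq (fun N => sum1 (fun h => u h N) p) (sum1 l p).
Proof.
  induction p as [|p IH]; intros H.
  - rewrite sum1_0.
    apply is_lim_seq_ext with (fun _ => 0); [|apply is_lim_seq_const].
    intros; now rewrite sum1_0.
  - rewrite sum1_S.
    apply is_lim_seq_ext with (fun N => sum1 (fun h => u h N) p + u (S p) N).
    + intros; now rewrite sum1_S.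
    + apply is_lim_seq_plus'; [apply IH; intros|]; apply H; lia.
Qed.

(* The term [k = 0] is [1 / 0 = 0]. *)
Definition harm (s : R) (n : nat) : R := sum_f_R0 (fun k => s ^ k / INR k) n.

Lemma harm_S (s : R) (n : nat) : harm s (S n) = harm s n + s ^ S n / INR (S n).
Proof. reflexivity. Qed.

Lemma harm_0 (s : R) : harm s 0 = 0.
Proof. unfold harm; simpl. unfold Rdiv. rewrite Rinv_0; ring. Qed.

Lemma pow_sqr_1 (s : R) (n : nat) : s * s = 1 -> s ^ n * s ^ n = 1.
Proof. intros H. now rewrite <- Rpow_mult_distr, H, pow1. Qed.

(** Put [k = i + j + 1] and use [s ^ i = s ^ S j * s ^ k]. Keeping [s] general covers both the
    character ([s = -1]) and the sums without it ([s = 1]). *)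
Lemma sum_pow_div_plus (s : R) (j N : nat) : s * s = 1 ->
  sum_f_R0 (fun i => s ^ i / (INR i + INR j + 1)) N =
  s ^ S j * (harm s (N + j + 1) - harm s j).
Proof.
  intros Hs; induction N as [|N IH].
  - simpl sum_f_R0. replace (0 + j + 1)%nat with (S j) by lia.
    rewrite harm_S, S_INR. pose proof (pow_sqr_1 s (S j) Hs) as E.
    transitivity (s ^ S j * s ^ S j / (INR j + 1)).
    + rewrite E. simpl. f_equal; ring.
    + unfold Rdiv; ring.
  - rewrite tech5, IH. replace (S N + j + 1)%nat with (S (N + j + 1)) by lia.
    rewrite harm_S. replace (S (N + j + 1)) with (S N + S j)%nat by lia.
    rewrite pow_add, plus_INR, (S_INR j). pose proof (pow_sqr_1 s (S j) Hs) as E.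
    transitivity (s ^ S j * (harm s (N + j + 1) - harm s j)
      + s ^ S j * s ^ S j * s ^ S N / (INR (S N) + INR j + 1)).
    + rewrite E. unfold Rdiv; ring.
    + replace (INR (S N) + (INR j + 1)) with (INR (S N) + INR j + 1) by ring.
      unfold Rdiv; ring.
Qed.

(** Here [k = i - j] takes both signs: [i > j] gives [harm s (N - j)], [i < j] gives [- harm s j],
    and the term [i = j] is [s ^ j / 0 = 0]. The induction peels off [i = 0] and shifts both indices
    by one. *)
Lemma sum_pow_div_minus (s : R) (j N : nat) : s * s = 1 -> (j <= N)%nat ->
  sum_f_R0 (fun i => s ^ i / (INR i - INR j)) N =
  s ^ j * (harm s (N - j) - harm s j).
Proof.
  intros Hs; revert N; induction j as [|j IH]; intros N HN.
  - rewrite harm_0, Nat.sub_0_r. simpl pow. rewrite Rmult_1_l, Rminus_0_r.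
    apply sum_eq; intros. simpl. f_equal; ring.
  - destruct N as [|N]; [lia|]. rewrite decomp_sum by lia. simpl Nat.pred.
    rewrite (sum_eq _ (fun i => s * (s ^ i / (INR i - INR j)))).
    2:{ intros i _. rewrite !S_INR. simpl pow. unfold Rdiv.
        replace (INR i + 1 - (INR j + 1)) with (INR i - INR j) by ring. ring. }
    rewrite sum_f_R0_mult_l, IH by lia. simpl Nat.sub. rewrite harm_S.
    pose proof (pow_sqr_1 s (S j) Hs) as E.
    transitivity (s ^ S j * (harm s (N - j) - harm s j) -
       s ^ S j * s ^ S j / INR (S j)).
    + rewrite E, S_INR. simpl. pose proof (pos_INR j). field; lra.
    + unfold Rdiv; ring.
Qed.

(** Leibniz's estimate: up to sign, a segment starting after [p] is its first term [1 / (p + 1)]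
    minus the segment starting after [p + 1], which lies between [0] and [1 / (p + 2)]. *)
Lemma harm_alt_bounds (p d : nat) :
  0 <= (-1) ^ S p * (harm (-1) (p + d) - harm (-1) p) <= / INR (S p).
Proof.
  revert p; induction d as [|d IH]; intros p.
  - rewrite Nat.add_0_r, Rminus_diag, Rmult_0_r.
    pose proof (Rinv_0_lt_compat _ (lt_0_INR (S p) ltac:(lia))). lra.
  - specialize (IH (S p)). replace (p + S d)%nat with (S p + d)%nat by lia.
    rewrite harm_S in IH. pose proof (pow_sqr_1 (-1) (S p) ltac:(ring)) as E.
    assert (F : / INR (S (S p)) <= / INR (S p)).
    { apply Rinv_le_contravar; [apply lt_0_INR; lia | apply le_INR; lia]. }
    set (y := harm (-1) (S p + d)) in *.
    replace ((-1) ^ S p * (y - harm (-1) p)) with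
      (/ INR (S p) - (-1) ^ S (S p) * (y - (harm (-1) p + (-1) ^ S p / INR (S p)))).
    + lra.
    + replace ((-1) ^ S (S p)) with (- (-1) ^ S p) by (simpl; ring).
      transitivity ((1 - (-1) ^ S p * (-1) ^ S p) / INR (S p) + (-1) ^ S p * (y - harm (-1) p)).
      * unfold Rdiv; ring.
      * rewrite E. unfold Rdiv; ring.
Qed.

Lemma harm_alt_dist (p q : nat) : (p <= q)%nat ->
  Rabs (harm (-1) q - harm (-1) p) <= / INR (S p).
Proof.
  intros H. pose proof (harm_alt_bounds p (q - p)) as B.
  replace (p + (q - p))%nat with q in B by lia.
  rewrite <- (Rmult_1_l (Rabs _)), <- (pow_1_abs (S p)), <- Rabs_mult.
  rewrite Rabs_pos_eq; lra.
Qed.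

(** A geometric progression of ratio [y / x], scaled by [y ^ -(p + 1)]. It is used with [x = n ^ 2]
    and [y = r ^ 2]. *)
Lemma partial_fractions (x y : R) (p : nat) : x <> 0 -> y <> 0 -> x <> y ->
  sum1 (fun h => / x ^ h * / y ^ (p + 1 - h)) p =
  (/ y ^ p - / x ^ p) * / (x - y).
Proof.
  intros Hx Hy Hxy.
  assert (G : forall q, sum1 (fun h => (y / x) ^ h) q
            = y * (1 - (y / x) ^ q) / (x - y)).
  { induction q as [|q IH].
    - rewrite sum1_0. simpl. field. lra.
    - rewrite sum1_S, IH. simpl. field. lra. }
  rewrite (sum1_ext _ (fun h => / y ^ (p + 1) * (y / x) ^ h)).
  - rewrite sum1_mult_l, G. unfold Rdiv. rewrite Rpow_mult_distr, pow_inv, pow_add.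
    simpl. field. repeat split; auto using pow_nonzero; lra.
  - intros h Hh. unfold Rdiv. rewrite Rpow_mult_distr, pow_inv.
    replace (p + 1)%nat with (p + 1 - h + h)%nat at 2 by lia.
    rewrite pow_add. field. repeat split; auto using pow_nonzero.
Qed.

(** * The square summation identity *)

(** Partial sums of [L(chi, q)] for [s = -1], and of the sum of [n ^ -q] over odd [n] for
    [s = 1]. *)
Definition odd_sum (s : R) (q N : nat) : R :=
  sum_f_R0 (fun i => s ^ i * / (2 * INR i + 1) ^ q) N.

Lemma odd_pos (i : nat) : 0 < 2 * INR i + 1.
Proof. pose proof (pos_INR i); lra. Qed.

(* On the diagonal [/ (n - r) = / 0 = 0], so the terms [i = j] need no separate
   treatment except for the correction on the right-hand side. *)
Lemma square_term (p i j : nat) :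
  let n := 2 * INR j + 1 in
  let r := 2 * INR i + 1 in
  / n ^ (2 * p + 1) * (/ (n + r) + / (n - r))
    + 2 * sum1 (fun h => / n ^ (2 * h) * / r ^ (2 * p + 2 - 2 * h)) p =
  / r ^ (2 * p + 1) * (/ (n - r) - / (n + r))
    + (if Nat.eqb i j then INR (2 * p + 1) * / r ^ (2 * p + 2) else 0).
Proof.
  intros n r. pose proof (odd_pos j : 0 < n) as Hn. pose proof (odd_pos i : 0 < r) as Hr.
  destruct (Nat.eqb_spec i j) as [->|Hij].
  (* For [n = r] every product is [n ^ -(2p+2)]; in this unit the sides are [1/2 + 2p] and
     [-1/2 + (2p + 1)]. *)
  - unfold r; fold n. rewrite Rminus_diag, Rinv_0.
    rewrite (sum1_ext _ (fun _ => / n ^ (2 * p + 2) * 1)).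
    2:{ intros h Hh. rewrite <- Rinv_mult, <- pow_add. rewrite Rmult_1_r.
        do 2 f_equal; lia. }
    rewrite sum1_mult_l.
    assert (E : sum1 (fun _ => 1) p = INR p).
    { clear. induction p as [|p IH]; [apply sum1_0 | now rewrite sum1_S, IH, S_INR]. }
    rewrite E, plus_INR, mult_INR. simpl (INR 2); simpl (INR 1).
    replace (2 * p + 2)%nat with (S (2 * p + 1)) by lia. simpl pow.
    field. split; [apply pow_nonzero|]; lra.
  - assert (Hnr : n <> r).
    { unfold n, r; intros E. apply Hij, INR_eq; lra. }
    rewrite (sum1_ext _ (fun h => / (n ^ 2) ^ h * / (r ^ 2) ^ (p + 1 - h))).
    2:{ intros h Hh. rewrite <- !pow_mult. do 3 f_equal; lia. }
    assert (E : n ^ 2 - r ^ 2 <> 0).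
    { replace (n ^ 2 - r ^ 2) with ((n - r) * (n + r)) by ring.
      apply Rmult_integral_contrapositive; split; lra. }
    rewrite partial_fractions by (try (apply pow_nonzero); lra).
    rewrite <- !pow_mult, !pow_add.
    simpl (_ ^ 1). simpl (_ ^ 2) in *. field.
    repeat split; try (apply pow_nonzero); lra.
Qed.

(** [square_term] times [s ^ i], summed over the square [i, j <= N]. The factors [/ 2] arise because
    [n + r = 2 (i + j + 1)] and [n - r = 2 (j - i)]. *)
Lemma odd_square_identity (p : nat) (s : R) (N : nat) : s * s = 1 ->
  / 2 * sum_f_R0 (fun j => / (2 * INR j + 1) ^ (2 * p + 1) *
      (s ^ S j * (harm s (N + j + 1) - harm s j) - s ^ j * (harm s (N - j) - harm s j))) N
    + 2 * sum1 (fun h => odd_sum 1 (2 * h) N * odd_sum s (2 * p + 2 - 2 * h) N) p =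
  INR (2 * p + 1) * odd_sum s (2 * p + 2) N
    - / 2 * sum_f_R0 (fun i => s ^ i * / (2 * INR i + 1) ^ (2 * p + 1) *
        (harm 1 (N + i + 1) - harm 1 (N - i))) N.
Proof.
  intros Hs.
  set (o := fun i => 2 * INR i + 1).
  assert (Row : forall j, (j <= N)%nat ->
    sum_f_R0 (fun i => s ^ i * (/ (o j + o i) + / (o j - o i))) N =
    / 2 * (s ^ S j * (harm s (N + j + 1) - harm s j)
            - s ^ j * (harm s (N - j) - harm s j))).
  { intros j Hj. rewrite <- sum_pow_div_plus, <- sum_pow_div_minus by assumption.
    rewrite <- minus_sum, <- sum_f_R0_mult_l. apply sum_eq; intros i _. unfold o, Rdiv.
    replace (2 * INR j + 1 + (2 * INR i + 1)) with (2 * (INR i + INR j + 1)) by ring.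
    replace (2 * INR j + 1 - (2 * INR i + 1)) with (2 * (- (INR i - INR j))) by ring.
    rewrite !Rinv_mult, Rinv_opp. ring. }
  (* On the right-hand side the weight depends on [i] alone, so the sum over [j] is unsigned and
     telescopes to a window of [2i + 1] harmonic terms around [N + 1]. *)
  assert (Col : forall i, (i <= N)%nat ->
    sum_f_R0 (fun j => / (o j - o i) - / (o j + o i)) N =
    - / 2 * (harm 1 (N + i + 1) - harm 1 (N - i))).
  { intros i Hi.
    pose proof (sum_pow_div_plus 1 i N ltac:(ring)) as P.
    pose proof (sum_pow_div_minus 1 i N ltac:(ring) Hi) as M.
    rewrite pow1, Rmult_1_l in P, M.
    replace (harm 1 (N + i + 1) - harm 1 (N - i)) with
      ((harm 1 (N + i + 1) - harm 1 i) - (harm 1 (N - i) - harm 1 i)) by ring.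
    rewrite <- P, <- M, <- minus_sum, <- sum_f_R0_mult_l. apply sum_eq; intros j _.
    unfold o, Rdiv.
    replace (2 * INR j + 1 + (2 * INR i + 1)) with (2 * (INR j + INR i + 1)) by ring.
    replace (2 * INR j + 1 - (2 * INR i + 1)) with (2 * (INR j - INR i)) by ring.
    rewrite !Rinv_mult, pow1. ring. }
  assert (T : sum_f_R0 (fun j => sum_f_R0 (fun i => s ^ i *
      (/ o j ^ (2 * p + 1) * (/ (o j + o i) + / (o j - o i))
       + 2 * sum1 (fun h => / o j ^ (2 * h) * / o i ^ (2 * p + 2 - 2 * h)) p)) N) N =
    sum_f_R0 (fun j => sum_f_R0 (fun i => s ^ i *
      (/ o i ^ (2 * p + 1) * (/ (o j - o i) - / (o j + o i))
       + (if Nat.eqb i j then INR (2 * p + 1) * / o i ^ (2 * p + 2) else 0))) N) N).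
  { apply sum_eq; intros j _. apply sum_eq; intros i _. f_equal. apply square_term. }
  replace (/ 2 * sum_f_R0 (fun j => / (2 * INR j + 1) ^ (2 * p + 1) *
      (s ^ S j * (harm s (N + j + 1) - harm s j) - s ^ j * (harm s (N - j) - harm s j))) N)
    with (sum_f_R0 (fun j => sum_f_R0 (fun i => s ^ i *
      (/ o j ^ (2 * p + 1) * (/ (o j + o i) + / (o j - o i)))) N) N).
  2:{ rewrite <- sum_f_R0_mult_l. apply sum_eq; intros j Hj.
      rewrite (sum_eq _ (fun i => / o j ^ (2 * p + 1) *
        (s ^ i * (/ (o j + o i) + / (o j - o i))))) by (intros; ring).
      rewrite sum_f_R0_mult_l, Row by assumption. unfold o; ring. }
  replace (sum1 (fun h => odd_sum 1 (2 * h) N * odd_sum s (2 * p + 2 - 2 * h) N) p)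
    with (sum_f_R0 (fun j => sum_f_R0 (fun i => s ^ i *
      sum1 (fun h => / o j ^ (2 * h) * / o i ^ (2 * p + 2 - 2 * h)) p) N) N).
  2:{ rewrite (sum1_ext _ (fun h => sum_f_R0 (fun j => sum_f_R0 (fun i =>
        s ^ i * (/ o j ^ (2 * h) * / o i ^ (2 * p + 2 - 2 * h))) N) N)).
      - rewrite sum1_swap. apply sum_eq; intros j _. rewrite sum1_swap.
        apply sum_eq; intros i _. now rewrite sum1_mult_l.
      - intros h _. unfold odd_sum. rewrite Rmult_comm, <- sum_f_R0_mult_l.
        apply sum_eq; intros j _. rewrite pow1, Rmult_1_l, Rmult_comm, <- sum_f_R0_mult_l.
        apply sum_eq; intros i _. unfold o; ring. }
  rewrite <- sum_f_R0_mult_l, <- sum_plus.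
  erewrite sum_eq; [rewrite T|].
  2:{ intros j _. rewrite <- sum_f_R0_mult_l, <- sum_plus. apply sum_eq; intros i _. ring. }
  replace (INR (2 * p + 1) * odd_sum s (2 * p + 2) N) with
    (sum_f_R0 (fun j => sum_f_R0 (fun i =>
      if Nat.eqb i j then s ^ i * (INR (2 * p + 1) * / o i ^ (2 * p + 2)) else 0) N) N).
  2:{ unfold odd_sum. rewrite <- sum_f_R0_mult_l. apply sum_eq; intros j Hj.
      rewrite (sum_f_R0_kronecker (fun i => s ^ i * (INR (2 * p + 1) * / o i ^ (2 * p + 2)))).
      destruct (Nat.leb_spec j N); [unfold o; ring | lia]. }
  replace (/ 2 * sum_f_R0 (fun i => s ^ i * / (2 * INR i + 1) ^ (2 * p + 1) *
        (harm 1 (N + i + 1) - harm 1 (N - i))) N)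
    with (- sum_f_R0 (fun j => sum_f_R0 (fun i => s ^ i *
      (/ o i ^ (2 * p + 1) * (/ (o j - o i) - / (o j + o i)))) N) N).
  2:{ rewrite sum_f_R0_swap. rewrite <- sum_f_R0_mult_l.
      replace (- sum_f_R0 _ N) with (-1 * sum_f_R0 (fun i => sum_f_R0 (fun j => s ^ i *
      (/ o i ^ (2 * p + 1) * (/ (o j - o i) - / (o j + o i)))) N) N) by ring.
      rewrite <- sum_f_R0_mult_l. apply sum_eq; intros i Hi.
      rewrite (sum_eq _ (fun j => s ^ i * / o i ^ (2 * p + 1) *
        (/ (o j - o i) - / (o j + o i)))) by (intros; ring).
      rewrite sum_f_R0_mult_l, Col by assumption. unfold o; ring. }
  lazymatch goal with |- _ = ?a - - ?b => replace (a - - b) with (b + a) by ring end.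
  rewrite <- sum_plus.
  apply sum_eq; intros j _. rewrite <- sum_plus. apply sum_eq; intros i _.
  destruct (Nat.eqb i j); ring.
Qed.

(** * Vanishing error terms *)

(** These are the Cesaro means of the null sequence [1 / k]. *)
Lemma harm_over_n : is_lim_seq (fun n => harm 1 n / INR n) 0.
Proof.
  apply is_lim_seq_ext_loc with
    (fun n => sum_f_R0 (fun k => / INR (S k)) (Nat.pred n) / INR n).
  - exists 1%nat; intros n Hn. f_equal. unfold harm. rewrite (decomp_sum _ n) by lia.
    simpl (1 ^ 0 / INR 0). unfold Rdiv at 1. rewrite Rinv_0, Rmult_0_r, Rplus_0_l.
    apply sum_eq; intros. rewrite pow1. unfold Rdiv; ring.
  - apply is_lim_seq_Reals, Cesaro_1, is_lim_seq_Reals.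
    apply -> (is_lim_seq_incr_1 (fun k => / INR k)).
    replace (Finite 0) with (Rbar_inv p_infty) by reflexivity.
    apply is_lim_seq_inv; [apply is_lim_seq_INR | discriminate].
Qed.

(** A common majorant for the error terms that are estimated in absolute value: a weight at most
    [1 / n] against a harmonic segment of size [O(1 / (N - j + 1))]. *)
Definition odd_conv (N : nat) : R :=
  sum_f_R0 (fun j => / (2 * INR j + 1) * / INR (S (N - j))) N.

Lemma inv_INR_S_pos (n : nat) : 0 < / INR (S n).
Proof. apply Rinv_0_lt_compat, lt_0_INR; lia. Qed.

(** Since [2j + 1 >= j + 1], each term is at most [1 / ((j+1) (N-j+1)) = (1/(j+1) + 1/(N-j+1)) /
    (N+2)], and both sums of reciprocals equal [harm 1 (S N)]. *)
Lemma odd_conv_bound (N : nat) : odd_conv N <= 2 * (harm 1 (S N) / INR (S N)).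
Proof.
  assert (H1 : sum_f_R0 (fun j => / INR (S j)) N = harm 1 (S N)).
  { induction N as [|N IH].
    - rewrite harm_S, harm_0. simpl. field.
    - rewrite tech5, IH, (harm_S 1 (S N)), pow1. unfold Rdiv; ring. }
  assert (H2 : sum_f_R0 (fun j => / INR (S (N - j))) N = harm 1 (S N)).
  { clear H1. induction N as [|N IH].
    - rewrite harm_S, harm_0. simpl. field.
    - rewrite decomp_sum by lia. rewrite (harm_S 1 (S N)), pow1. simpl Nat.pred.
      rewrite <- IH. simpl Nat.sub. unfold Rdiv; ring. }
  apply Rle_trans with (sum_f_R0 (fun j => / INR (S N) * (/ INR (S j) + / INR (S (N - j)))) N).
  - apply sum_Rle; intros j Hj. pose proof (pos_INR j) as P. pose proof (pos_INR (N - j)) as Q.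
    assert (E : INR (S N) = INR j + INR (N - j) + 1).
    { rewrite <- plus_INR, S_INR. do 2 f_equal; lia. }
    apply Rle_trans with (/ INR (S j) * / INR (S (N - j))).
    + apply Rmult_le_compat_r; [left; apply inv_INR_S_pos|].
      rewrite S_INR. apply Rinv_le_contravar; lra.
    + rewrite E, !S_INR.
      replace (/ (INR j + 1) + / (INR (N - j) + 1)) with
        ((INR j + INR (N - j) + 1 + 1) * (/ (INR j + 1) * / (INR (N - j) + 1)))
        by (field; lra).
      rewrite <- Rmult_assoc. set (a := INR j + INR (N - j) + 1).
      assert (Ha : 0 < a) by (unfold a; lra).
      replace (/ a * (a + 1)) with (1 + / a) by (field; lra).
      pose proof (Rinv_0_lt_compat _ Ha).
      assert (0 <= / (INR j + 1) * / (INR (N - j) + 1)).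
      { apply Rmult_le_pos; left; apply Rinv_0_lt_compat; lra. }
      nra.
  - rewrite sum_f_R0_mult_l, sum_plus, H1, H2. right; unfold Rdiv; ring.
Qed.

Lemma is_lim_seq_0_of_odd_conv (c : R) (u : nat -> R) :
  0 <= c -> (forall N, Rabs (u N) <= c * odd_conv N) -> is_lim_seq u 0.
Proof.
  intros Hc Hu. apply is_lim_seq_abs_0.
  apply is_lim_seq_le_le with (fun _ => 0) (fun N => c * (2 * (harm 1 (S N) / INR (S N)))).
  - intros N; split; [apply Rabs_pos|].
    apply Rle_trans with (1 := Hu N). apply Rmult_le_compat_l; [exact Hc|].
    apply odd_conv_bound.
  - apply is_lim_seq_const.
  - replace (Finite 0) with (Finite (c * (2 * 0))) by (f_equal; ring).
    apply is_lim_seq_mult'; [apply is_lim_seq_const|].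
    apply is_lim_seq_mult'; [apply is_lim_seq_const|].
    apply -> (is_lim_seq_incr_1 (fun n => harm 1 n / INR n)). apply harm_over_n.
Qed.

Lemma sum_f_R0_odd_conv (c : R) (u : nat -> R) (N : nat) :
  (forall j, (j <= N)%nat ->
     Rabs (u j) <= c * (/ (2 * INR j + 1) * / INR (S (N - j)))) ->
  Rabs (sum_f_R0 u N) <= c * odd_conv N.
Proof.
  intros H. apply Rle_trans with (1 := Rsum_abs _ _).
  unfold odd_conv. rewrite <- sum_f_R0_mult_l. now apply sum_Rle.
Qed.

Lemma harm_1_diff (a d : nat) :
  0 <= harm 1 (a + d) - harm 1 a <= INR d * / INR (S a).
Proof.
  induction d as [|d IH].
  - rewrite Nat.add_0_r. simpl; lra.
  - rewrite Nat.add_succ_r, harm_S, pow1, (S_INR d).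
    assert (/ INR (S (a + d)) <= / INR (S a)).
    { apply Rinv_le_contravar; [apply lt_0_INR; lia | apply le_INR; lia]. }
    pose proof (inv_INR_S_pos (a + d)). unfold Rdiv. lra.
Qed.

Lemma harm_1_window (N i : nat) : (i <= N)%nat ->
  0 <= harm 1 (N + i + 1) - harm 1 (N - i) <= (2 * INR i + 1) * / INR (S (N - i)).
Proof.
  intros Hi. pose proof (harm_1_diff (N - i) (2 * i + 1)) as H.
  replace (N - i + (2 * i + 1))%nat with (N + i + 1)%nat in H by (clear H; lia).
  rewrite plus_INR, mult_INR in H. exact H.
Qed.

Lemma Rabs_pow_sqr_1 (s : R) (i : nat) : s * s = 1 -> Rabs (s ^ i) = 1.
Proof.
  intros H. assert (E : (s - 1) * (s + 1) = 0) by lra.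
  destruct (Rmult_integral _ _ E).
  - replace s with 1 by lra. rewrite pow1. apply Rabs_R1.
  - replace s with (-1) by lra. apply pow_1_abs.
Qed.

(** The boundary terms left by the telescoping in [odd_square_identity]. *)
Definition window_error (p : nat) (s : R) (N : nat) : R :=
  sum_f_R0 (fun i => s ^ i * / (2 * INR i + 1) ^ (2 * p + 1) *
    (harm 1 (N + i + 1) - harm 1 (N - i))) N.

(** The window is at most [n / (N - i + 1)]. With exponent at least 3, one factor [1 / n] cancels
    this [n] and another one remains as the weight in [odd_conv]. *)
Lemma window_error_lim (p : nat) (s : R) : s * s = 1 ->
  is_lim_seq (window_error (S p) s) 0.
Proof.
  intros Hs. apply is_lim_seq_0_of_odd_conv with 1; [lra|]. intros N.
  apply sum_f_R0_odd_conv. intros i Hi.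
  pose proof (harm_1_window N i Hi) as W. pose proof (odd_pos i) as O.
  pose proof (inv_INR_S_pos (N - i)) as Q.
  set (n := 2 * INR i + 1) in *.
  assert (Hn : 1 <= n) by (unfold n; pose proof (pos_INR i); lra).
  assert (Hp : 0 < / n ^ (2 * S p + 1)) by (now apply Rinv_0_lt_compat, pow_lt).
  rewrite !Rabs_mult, Rabs_pow_sqr_1, (Rabs_pos_eq (/ _)), (Rabs_pos_eq (_ - _)) by lra.
  apply Rle_trans with (/ n ^ (2 * S p + 1) * (n * / INR (S (N - i)))).
  - rewrite Rmult_1_l. apply Rmult_le_compat_l; lra.
  - rewrite Rmult_1_l, <- Rmult_assoc. apply Rmult_le_compat_r; [lra|].
    replace (2 * S p + 1)%nat with (S (S (2 * p + 1))) by lia.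
    generalize (2 * p + 1)%nat as k; intros k. simpl pow.
    replace (/ (n * (n * n ^ k)) * n) with (/ (n * n ^ k)).
    + apply Rinv_le_contravar; [lra|]. pose proof (pow_R1_Rle n k Hn). nra.
    + field. split; [apply pow_nonzero|]; lra.
Qed.

(** Read backwards, the sum alternates with decreasing terms, so the last term dominates. *)
Lemma alternating_sum_increasing (g : nat -> R) (N : nat) :
  (forall i, (i <= N)%nat -> 0 <= g i) ->
  (forall i, (i < N)%nat -> g i <= g (S i)) ->
  0 <= (-1) ^ N * sum_f_R0 (fun i => (-1) ^ i * g i) N <= g N.
Proof.
  induction N as [|N IH]; intros H0 Hg.
  - simpl. specialize (H0 0%nat ltac:(lia)). lra.
  - rewrite tech5.
    assert (B := IH ltac:(intros; apply H0; lia) ltac:(intros; apply Hg; lia)).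
    specialize (Hg N ltac:(lia)).
    pose proof (pow_sqr_1 (-1) (S N) ltac:(ring)) as E.
    rewrite Rmult_plus_distr_l, <- Rmult_assoc, E.
    simpl pow. lra.
Qed.

(** Each side is the mean of [1 / k] over a window centred at [N + 1]. Widening it adds
    [1 / (N - i)] and [1 / (N + i + 2)], whose mean is no smaller because [1 / x] is convex. *)
Lemma window_mean_increasing (N i : nat) : (i < N)%nat ->
  / (2 * INR i + 1) * (harm 1 (N + i + 1) - harm 1 (N - i)) <=
  / (2 * INR (S i) + 1) * (harm 1 (N + S i + 1) - harm 1 (N - S i)).
Proof.
  intros HiN.
  set (G := fun i => harm 1 (N + i + 1) - harm 1 (N - i)).
  set (c := fun i => / INR (N - i) + / INR (N + i + 2)).
  assert (Step : forall i, (i < N)%nat -> G (S i) = G i + c i).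
  { intros k Hk. unfold G, c.
    replace (N + S k + 1)%nat with (S (N + k + 1)) by lia. rewrite harm_S, pow1.
    replace (N - k)%nat with (S (N - S k)) by lia. rewrite (harm_S 1 (N - S k)), pow1.
    replace (S (N + k + 1)) with (N + k + 2)%nat by lia. unfold Rdiv; ring. }
  (* The two denominators have constant sum [2N + 2], while their product decreases as [i] grows. *)
  assert (Mono : forall i, (S i < N)%nat -> c i <= c (S i)).
  { intros k Hk. unfold c.
    rewrite !minus_INR, !plus_INR, !(S_INR k) by lia. change (INR 2) with 2.
    assert (INR k + 2 <= INR N).
    { replace 2 with (INR 2) by reflexivity. rewrite <- plus_INR. apply le_INR; lia. }
    pose proof (pos_INR k).
    set (x := INR N) in *. set (t := INR k) in *.
    replace (/ (x - t) + / (x + t + 2)) with ((2 * x + 2) / ((x - t) * (x + t + 2)))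
      by (field; lra).
    replace (/ (x - (t + 1)) + / (x + (t + 1) + 2)) with
      ((2 * x + 2) / ((x - (t + 1)) * (x + (t + 1) + 2))) by (field; lra).
    apply Rmult_le_compat_l; [lra|]. apply Rinv_le_contravar; [|nra].
    apply Rmult_lt_0_compat; lra. }
  (* The current mean is at most the mean of the pair to be added: [2 G(k+1) = 2 G(k) + 2 c(k) <=
     (2k+3) c(k) <= (2k+3) c(k+1)]. *)
  assert (Mean : forall i, (i < N)%nat -> 2 * G i <= (2 * INR i + 1) * c i).
  { intros k. induction k as [|k IH]; intros Hk.
    - unfold G, c. rewrite Nat.sub_0_r, !Nat.add_0_r.
      replace (N + 1)%nat with (S N) by lia. rewrite harm_S, pow1.
      replace (N + 2)%nat with (S (S N)) by lia.
      rewrite !S_INR. simpl (INR 0).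
      assert (0 < INR N) by (apply lt_0_INR; lia).
      assert (2 / (INR N + 1) <= / INR N + / (INR N + 1 + 1)).
      { replace (/ INR N + / (INR N + 1 + 1)) with (2 * ((INR N + 1) / (INR N * (INR N + 2))))
          by (field; lra).
        apply Rmult_le_compat_l; [lra|].
        apply Rle_div_r; [nra|].
        replace (/ (INR N + 1) * (INR N * (INR N + 2))) with
          (INR N + 1 - / (INR N + 1)) by (field; lra).
        pose proof (Rinv_0_lt_compat (INR N + 1) ltac:(lra)); lra. }
      unfold Rdiv in *. lra.
    - rewrite Step by lia. specialize (IH ltac:(lia)). specialize (Mono k Hk).
      rewrite S_INR. pose proof (pos_INR k). nra. }
  fold (G i). fold (G (S i)). rewrite Step by assumption. specialize (Mean i HiN).
  rewrite S_INR. pose proof (pos_INR i).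
  replace (/ (2 * INR i + 1) * G i) with
    (/ (2 * INR i + 1) * / (2 * (INR i + 1) + 1) * ((2 * (INR i + 1) + 1) * G i)) by (field; lra).
  replace (/ (2 * (INR i + 1) + 1) * (G i + c i)) with
    (/ (2 * INR i + 1) * / (2 * (INR i + 1) + 1) * ((2 * INR i + 1) * (G i + c i)))
    by (field; lra).
  apply Rmult_le_compat_l; [|lra].
  apply Rmult_le_pos; left; apply Rinv_0_lt_compat; lra.
Qed.

(** For exponent 1 absolute values do not suffice: there are [N + 1] means, each at least
    [1 / (N + 1)]. As they increase with [i], the alternating sum is bounded by the last one,
    [harm 1 (2N+1) / (2N+1)]. *)
Lemma window_error_alt_0_lim : is_lim_seq (window_error 0 (-1)) 0.
Proof.
  set (g := fun N i => / (2 * INR i + 1) * (harm 1 (N + i + 1) - harm 1 (N - i))).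
  apply is_lim_seq_abs_0.
  apply is_lim_seq_le_le with (fun _ => 0) (fun N => harm 1 (2 * N + 1) / INR (2 * N + 1)).
  - intros N. split; [apply Rabs_pos|].
    assert (B : 0 <= (-1) ^ N * sum_f_R0 (fun i => (-1) ^ i * g N i) N <= g N N).
    { apply alternating_sum_increasing.
      - intros i Hi. unfold g. apply Rmult_le_pos.
        + left; apply Rinv_0_lt_compat, odd_pos.
        + now apply harm_1_window.
      - intros i Hi. now apply window_mean_increasing. }
    replace (window_error 0 (-1) N) with (sum_f_R0 (fun i => (-1) ^ i * g N i) N).
    2:{ apply sum_eq; intros i _. unfold g. simpl (2 * 0 + 1)%nat. rewrite pow_1. ring. }
    set (T := sum_f_R0 _ _) in *.
    replace (Rabs T) with (Rabs ((-1) ^ N * T)) by (rewrite Rabs_mult, pow_1_abs; ring).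
    rewrite Rabs_pos_eq by apply B. apply Rle_trans with (1 := proj2 B).
    unfold g. rewrite Nat.sub_diag, harm_0.
    replace (N + N + 1)%nat with (2 * N + 1)%nat by lia.
    rewrite plus_INR, mult_INR. change (INR 2) with 2. change (INR 1) with 1.
    right; unfold Rdiv; ring.
  - apply is_lim_seq_const.
  - apply (is_lim_seq_subseq (fun n => harm 1 n / INR n) 0 (fun N => (2 * N + 1)%nat)).
    + intros P [M HM]. exists M. intros n Hn. apply HM; lia.
    + apply harm_over_n.
Qed.

(** * Limits of the partial sums *)

Lemma chi_m4_odd (k : nat) : chi_m4 (S (2 * k)) = (-1) ^ k.
Proof.
  unfold chi_m4. destruct (Nat.Even_or_Odd k) as [[q ->]|[q ->]].
  - replace (S (2 * (2 * q)))%nat with (1 + q * 4)%nat by lia.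
    rewrite Nat.Div0.mod_add, pow_1_even. reflexivity.
  - replace (S (2 * (2 * q + 1)))%nat with (3 + q * 4)%nat by lia.
    rewrite Nat.Div0.mod_add, Nat.add_1_r, pow_1_odd. reflexivity.
Qed.

Lemma chi_m4_even (k : nat) : chi_m4 (2 * k) = 0.
Proof.
  unfold chi_m4. destruct (Nat.Even_or_Odd k) as [[q ->]|[q ->]].
  - replace (2 * (2 * q))%nat with (0 + q * 4)%nat by lia.
    now rewrite Nat.Div0.mod_add.
  - replace (2 * (2 * q + 1))%nat with (2 + q * 4)%nat by lia.
    now rewrite Nat.Div0.mod_add.
Qed.

(** Even integers contribute nothing, and the odd integers up to [M + 1] are [2k + 1] with
    [k <= M / 2]. *)
Lemma sum_chi_m4 (q M : nat) :
  sum_f_R0 (fun i => chi_m4 (S i) / INR (S i) ^ q) M = odd_sum (-1) q (M / 2).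
Proof.
  assert (H : forall k,
    sum_f_R0 (fun i => chi_m4 (S i) / INR (S i) ^ q) (2 * k) = odd_sum (-1) q k /\
    sum_f_R0 (fun i => chi_m4 (S i) / INR (S i) ^ q) (S (2 * k)) = odd_sum (-1) q k).
  { assert (Odd : forall k, sum_f_R0 (fun i => chi_m4 (S i) / INR (S i) ^ q) (S (2 * k)) =
      sum_f_R0 (fun i => chi_m4 (S i) / INR (S i) ^ q) (2 * k)).
    { intros k. rewrite tech5. replace (S (S (2 * k))) with (2 * S k)%nat by lia.
      rewrite chi_m4_even. unfold Rdiv; ring. }
    intros k. rewrite Odd. cut (sum_f_R0 (fun i => chi_m4 (S i) / INR (S i) ^ q) (2 * k)
      = odd_sum (-1) q k); [tauto|].
    assert (Term : forall k, chi_m4 (S (2 * k)) / INR (S (2 * k)) ^ q =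
      (-1) ^ k * / (2 * INR k + 1) ^ q).
    { intros j. rewrite chi_m4_odd, S_INR, mult_INR. reflexivity. }
    induction k as [|k IH].
    - apply (Term 0%nat).
    - replace (2 * S k)%nat with (S (S (2 * k))) by lia. rewrite tech5, Odd, IH.
      replace (S (S (2 * k))) with (2 * S k)%nat by lia. now rewrite Term. }
  destruct (Nat.Even_or_Odd M) as [[k ->]|[k ->]].
  - replace (2 * k / 2)%nat with k by (rewrite Nat.mul_comm, Nat.div_mul; lia).
    apply H.
  - replace ((2 * k + 1) / 2)%nat with k
      by (rewrite (Nat.mul_comm 2 k), Nat.add_comm, Nat.div_add by lia; reflexivity).
    rewrite Nat.add_1_r. apply H.
Qed.

(** Leibniz's criterion gives a limit; the partial sums of the full series are [odd_sum (-1) q]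
    reindexed by [M / 2], so they share it. *)
Lemma odd_sum_alt_cv (q : nat) : (1 <= q)%nat ->
  is_lim_seq (odd_sum (-1) q) (L_chi_m4 q).
Proof.
  intros Hq.
  assert (C : ex_finite_lim_seq (odd_sum (-1) q)).
  { destruct (alternated_series (fun i => / (2 * INR i + 1) ^ q)) as [l Hl].
    - intros i. pose proof (odd_pos i).
      apply Rinv_le_contravar; [now apply pow_lt|].
      apply pow_incr. rewrite S_INR. lra.
    - apply is_lim_seq_Reals.
      apply is_lim_seq_le_le with (fun _ => 0) (fun i => / INR (S i)).
      + intros i. pose proof (pos_INR i). split.
        * left; apply Rinv_0_lt_compat, pow_lt, odd_pos.
        * apply Rinv_le_contravar; [apply lt_0_INR; lia|].
          rewrite S_INR. apply Rle_trans with ((2 * INR i + 1) ^ 1); [simpl; lra|].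
          apply Rle_pow; [lra | exact Hq].
      + apply is_lim_seq_const.
      + apply -> (is_lim_seq_incr_1 (fun k => / INR k)).
        replace (Finite 0) with (Rbar_inv p_infty) by reflexivity.
        apply is_lim_seq_inv; [apply is_lim_seq_INR | discriminate].
    - exists l. apply is_lim_seq_Reals. exact Hl. }
  destruct C as [l Hl].
  replace (L_chi_m4 q) with l; [exact Hl|].
  symmetry; apply is_series_unique.
  change (is_lim_seq (sum_n (fun i => chi_m4 (S i) / INR (S i) ^ q)) l).
  apply (is_lim_seq_ext (fun M => odd_sum (-1) q (M / 2))).
  - intros M. now rewrite sum_n_Reals, sum_chi_m4.
  - apply (is_lim_seq_subseq _ _ (fun M => (M / 2)%nat)); [|exact Hl].
    intros P [K HK]. exists (2 * K)%nat. intros M HM. apply HK.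
    apply Nat.div_le_lower_bound; lia.
Qed.

Lemma odd_sum_alt_1_lim : is_lim_seq (odd_sum (-1) 1) (PI / 4).
Proof.
  rewrite <- Alt_PI_eq. unfold Alt_PI. destruct exist_PI as [a Ha].
  replace (4 * a / 4) with a by field.
  apply is_lim_seq_ext with (2 := proj2 (is_lim_seq_Reals _ _) Ha).
  intros N. apply sum_eq; intros i _. unfold tg_alt, PI_tg.
  rewrite plus_INR, mult_INR, pow_1. reflexivity.
Qed.

(* Both [1/(n r) = (1/n + 1/r)/(n + r)] and, off the diagonal,
   [1/(n r) = (1/n - 1/r)/(r - n)] are summed against [chi n * chi r] over a square. *)
Lemma odd_sum_square_identity (N : nat) :
  2 * (odd_sum (-1) 1 N * odd_sum (-1) 1 N) - odd_sum 1 2 N =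
  sum_f_R0 (fun j => / (2 * INR j + 1) *
    (harm (-1) (N - j) - harm (-1) (N + j + 1))) N.
Proof.
  set (h := harm (-1)). set (o := fun i => 2 * INR i + 1).
  assert (Prod : odd_sum (-1) 1 N * odd_sum (-1) 1 N =
    sum_f_R0 (fun j => sum_f_R0 (fun i => (-1) ^ j * (-1) ^ i * (/ o j * / o i)) N) N).
  { unfold odd_sum at 1. rewrite Rmult_comm, <- sum_f_R0_mult_l. apply sum_eq; intros j _.
    rewrite Rmult_comm. unfold odd_sum. rewrite <- sum_f_R0_mult_l. apply sum_eq; intros i _.
    rewrite !pow_1. unfold o; ring. }
  assert (Row1 : forall j, (j <= N)%nat ->
    sum_f_R0 (fun i => (-1) ^ j * (-1) ^ i * (/ o j * / (INR i + INR j + 1))) N =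
    / o j * (h j - h (N + j + 1)%nat)).
  { intros j Hj. pose proof (sum_pow_div_plus (-1) j N ltac:(ring)) as E.
    rewrite (sum_eq _ (fun i => (-1) ^ j * / o j * ((-1) ^ i / (INR i + INR j + 1))))
      by (intros; unfold Rdiv; ring).
    rewrite sum_f_R0_mult_l, E. fold h.
    pose proof (pow_sqr_1 (-1) j ltac:(ring)) as Q. simpl pow.
    transitivity ((-1) ^ j * (-1) ^ j * / o j * (h j - h (N + j + 1)%nat)); [ring|].
    rewrite Q; ring. }
  assert (Row2 : forall j, (j <= N)%nat ->
    sum_f_R0 (fun i => (-1) ^ j * (-1) ^ i * (/ o j * / (INR i - INR j))) N =
    / o j * (h (N - j)%nat - h j)).
  { intros j Hj. pose proof (sum_pow_div_minus (-1) j N ltac:(ring) Hj) as E.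
    rewrite (sum_eq _ (fun i => (-1) ^ j * / o j * ((-1) ^ i / (INR i - INR j))))
      by (intros; unfold Rdiv; ring).
    rewrite sum_f_R0_mult_l, E. fold h.
    pose proof (pow_sqr_1 (-1) j ltac:(ring)) as Q.
    transitivity ((-1) ^ j * (-1) ^ j * / o j * (h (N - j)%nat - h j)); [ring|].
    rewrite Q; ring. }
  assert (I1 : odd_sum (-1) 1 N * odd_sum (-1) 1 N =
    sum_f_R0 (fun j => / o j * (h j - h (N + j + 1)%nat)) N).
  (* The halves with [1/n] and [1/r] are exchanged by swapping [i] and [j], so each contributes half
     of the [Row1] sum. *)
  { rewrite Prod.
    transitivity (sum_f_R0 (fun j => sum_f_R0 (fun i =>
        (-1) ^ j * (-1) ^ i * (/ o j * / (INR i + INR j + 1))) N) N * / 2 +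
      sum_f_R0 (fun j => sum_f_R0 (fun i =>
        (-1) ^ i * (-1) ^ j * (/ o i * / (INR j + INR i + 1))) N) N * / 2).
    - rewrite !(Rmult_comm _ (/ 2)), <- !sum_f_R0_mult_l, <- sum_plus.
      apply sum_eq; intros j _. rewrite <- !sum_f_R0_mult_l, <- sum_plus.
      apply sum_eq; intros i _. unfold o. pose proof (pos_INR i). pose proof (pos_INR j).
      field; lra.
    - rewrite (sum_f_R0_swap (fun j i => (-1) ^ i * (-1) ^ j * (/ o i * / (INR j + INR i + 1)))).
      rewrite (sum_eq _ _ _ Row1). field. }
  assert (I2 : odd_sum (-1) 1 N * odd_sum (-1) 1 N - odd_sum 1 2 N =
    sum_f_R0 (fun j => / o j * (h (N - j)%nat - h j)) N).
  { rewrite Prod.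
    replace (odd_sum 1 2 N) with (sum_f_R0 (fun j => sum_f_R0 (fun i =>
      if Nat.eqb i j then / o i ^ 2 else 0) N) N).
    2:{ apply sum_eq; intros j Hj. rewrite (sum_f_R0_kronecker (fun i => / o i ^ 2)).
        rewrite pow1. destruct (Nat.leb_spec j N); [unfold o; ring | lia]. }
    transitivity (sum_f_R0 (fun j => sum_f_R0 (fun i =>
        (-1) ^ j * (-1) ^ i * (/ o j * / (INR i - INR j))) N) N * / 2 +
      sum_f_R0 (fun j => sum_f_R0 (fun i =>
        (-1) ^ i * (-1) ^ j * (/ o i * / (INR j - INR i))) N) N * / 2).
    - rewrite !(Rmult_comm _ (/ 2)), <- !sum_f_R0_mult_l, <- sum_plus, <- minus_sum.
      apply sum_eq; intros j _. rewrite <- !sum_f_R0_mult_l, <- sum_plus, <- minus_sum.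
      apply sum_eq; intros i _. unfold o. pose proof (odd_pos i). pose proof (odd_pos j).
      destruct (Nat.eqb_spec i j) as [->|Hij].
      (* On the diagonal the product [n ^ -2] is removed by [odd_sum 1 2], and both fractions are
         [/ 0 = 0]. *)
      + rewrite Rminus_diag, Rinv_0, pow_sqr_1 by ring. field. lra.
      + assert (INR i <> INR j) by now intros E%INR_eq. field. lra.
    - rewrite (sum_f_R0_swap (fun j i => (-1) ^ i * (-1) ^ j * (/ o i * / (INR j - INR i)))).
      rewrite (sum_eq _ _ _ Row2). field. }
  replace (2 * (odd_sum (-1) 1 N * odd_sum (-1) 1 N) - odd_sum 1 2 N) with
    (odd_sum (-1) 1 N * odd_sum (-1) 1 N +
      (odd_sum (-1) 1 N * odd_sum (-1) 1 N - odd_sum 1 2 N)) by ring.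
  rewrite I2, I1, <- sum_plus. apply sum_eq; intros; unfold o; ring.
Qed.

(** The value is [2 (PI / 4) ^ 2]; the alternating segments starting at [N - j] are at most
    [1 / (N - j + 1)], so the remainder is dominated by [odd_conv]. *)
Lemma odd_sum_2_lim : is_lim_seq (odd_sum 1 2) (PI ^ 2 / 8).
Proof.
  set (d := fun N => sum_f_R0 (fun j => / (2 * INR j + 1) *
    (harm (-1) (N - j) - harm (-1) (N + j + 1))) N).
  apply is_lim_seq_ext with (fun N => 2 * (odd_sum (-1) 1 N * odd_sum (-1) 1 N) - d N).
  - intros N. unfold d. rewrite <- odd_sum_square_identity. ring.
  - replace (PI ^ 2 / 8) with (2 * (PI / 4 * (PI / 4)) - 0) by field.
    apply is_lim_seq_minus'.
    + apply is_lim_seq_mult'; [apply is_lim_seq_const|].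
      apply is_lim_seq_mult'; apply odd_sum_alt_1_lim.
    + apply is_lim_seq_0_of_odd_conv with 1; [lra|]. intros N.
      apply sum_f_R0_odd_conv. intros j Hj. pose proof (odd_pos j).
      rewrite Rabs_mult, Rabs_pos_eq by (left; now apply Rinv_0_lt_compat).
      rewrite Rmult_1_l. apply Rmult_le_compat_l; [left; now apply Rinv_0_lt_compat|].
      rewrite Rabs_minus_sym. apply harm_alt_dist; lia.
Qed.

(** For [s = 1] both error terms of [odd_square_identity] are half of [window_error]. Strong
    induction then yields the existence of each limit together with its value. *)
Lemma odd_sum_even_lim (e : nat -> R) :
  e 1%nat = PI ^ 2 / 8 ->
  (forall p, (1 <= p)%nat ->
     INR (2 * p + 1) * e (S p) = 2 * sum1 (fun h => e h * e (S p - h)%nat) p) ->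
  forall h, (1 <= h)%nat -> is_lim_seq (odd_sum 1 (2 * h)) (e h).
Proof.
  intros E1 Erec h. induction h as [h IH] using lt_wf_ind. intros Hh.
  destruct h as [|[|p]]; [lia | rewrite E1; apply odd_sum_2_lim |].
  set (q := S p) in *.
  assert (Hq : INR (2 * q + 1) <> 0) by (apply not_0_INR; lia).
  apply is_lim_seq_ext with (fun N => / INR (2 * q + 1) *
    (2 * sum1 (fun h => odd_sum 1 (2 * h) N * odd_sum 1 (2 * q + 2 - 2 * h) N) q
      + window_error q 1 N)).
  - intros N. pose proof (odd_square_identity q 1 N ltac:(ring)) as I.
    replace (sum_f_R0 (fun j => / (2 * INR j + 1) ^ (2 * q + 1) *
      (1 ^ S j * (harm 1 (N + j + 1) - harm 1 j) - 1 ^ j * (harm 1 (N - j) - harm 1 j))) N)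
      with (window_error q 1 N) in I
      by (apply sum_eq; intros; rewrite !pow1; ring).
    fold (window_error q 1 N) in I.
    replace (2 * S q)%nat with (2 * q + 2)%nat by lia.
    set (X := odd_sum 1 (2 * q + 2) N) in *.
    replace X with (/ INR (2 * q + 1) * (INR (2 * q + 1) * X)) by (field; exact Hq).
    f_equal. lra.
  - replace (e (S q)) with (/ INR (2 * q + 1) *
      (2 * sum1 (fun h => e h * e (S q - h)%nat) q + 0)).
    2:{ rewrite Rplus_0_r, <- Erec by (unfold q; lia). field. exact Hq. }
    apply is_lim_seq_mult'; [apply is_lim_seq_const|].
    apply is_lim_seq_plus'; [|apply window_error_lim; ring].
    apply is_lim_seq_mult'; [apply is_lim_seq_const|].
    apply (is_lim_seq_sum1 (fun h N => odd_sum 1 (2 * h) N * odd_sum 1 (2 * q + 2 - 2 * h) N)).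
    intros h Hhq. replace (2 * q + 2 - 2 * h)%nat with (2 * (S q - h))%nat by lia.
    apply is_lim_seq_mult'; apply IH; lia.
Qed.

(** The case [s = -1] of [odd_square_identity], once the segment ends [N + j + 1] and [N - j] are
    both moved to [N + 1]; [d] is the cost of this move. *)
Lemma alternating_double_sum_lim (p : nat) (e : nat -> R) :
  (forall h, (1 <= h)%nat -> is_lim_seq (odd_sum 1 (2 * h)) (e h)) ->
  is_lim_seq (fun N => sum_f_R0 (fun j => (-1) ^ j * / (2 * INR j + 1) ^ (2 * p + 1) *
      (harm (-1) j - harm (-1) (S N))) N)
    (INR (2 * p + 1) * L_chi_m4 (2 * p + 2)
      - 2 * sum1 (fun h => e h * L_chi_m4 (2 * p + 2 - 2 * h)) p).
Proof.
  intros He. set (h := harm (-1)).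
  set (d := fun N => sum_f_R0 (fun j => (-1) ^ j * / (2 * INR j + 1) ^ (2 * p + 1) *
      ((h (N + j + 1)%nat - h (S N)) + (h (N - j)%nat - h (S N)))) N).
  apply is_lim_seq_ext with (fun N =>
    INR (2 * p + 1) * odd_sum (-1) (2 * p + 2) N - / 2 * window_error p (-1) N
    - 2 * sum1 (fun h => odd_sum 1 (2 * h) N * odd_sum (-1) (2 * p + 2 - 2 * h) N) p
    + / 2 * d N).
  - intros N. unfold window_error. rewrite <- odd_square_identity by ring.
    fold h. set (S1 := sum1 _ p).
    match goal with |- / 2 * ?x + 2 * S1 - 2 * S1 + / 2 * d N = ?y =>
      assert (E : x + d N = 2 * y); [|lra] end.
    unfold d. rewrite <- sum_plus, <- sum_f_R0_mult_l. apply sum_eq; intros j _.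
    simpl ((-1) ^ S j). ring.
  - replace (INR (2 * p + 1) * L_chi_m4 (2 * p + 2)
      - 2 * sum1 (fun h => e h * L_chi_m4 (2 * p + 2 - 2 * h)) p) with
     (INR (2 * p + 1) * L_chi_m4 (2 * p + 2) - / 2 * 0
      - 2 * sum1 (fun h => e h * L_chi_m4 (2 * p + 2 - 2 * h)) p + / 2 * 0) by ring.
    apply is_lim_seq_plus'; [apply is_lim_seq_minus'; [apply is_lim_seq_minus'|]|];
      (apply is_lim_seq_mult'; [apply is_lim_seq_const|]).
    + apply odd_sum_alt_cv; lia.
    + destruct p as [|p]; [apply window_error_alt_0_lim | apply window_error_lim; ring].
    + apply (is_lim_seq_sum1 (fun h N =>
        odd_sum 1 (2 * h) N * odd_sum (-1) (2 * p + 2 - 2 * h) N)).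
      intros k Hk. apply is_lim_seq_mult'; [apply He; lia | apply odd_sum_alt_cv; lia].
    + apply is_lim_seq_0_of_odd_conv with 2; [lra|]. intros N.
      apply sum_f_R0_odd_conv. intros j Hj. pose proof (odd_pos j) as O.
      pose proof (Rinv_0_lt_compat _ O).
      rewrite !Rabs_mult, pow_1_abs, Rmult_1_l.
      rewrite (Rabs_pos_eq (/ _)) by (left; now apply Rinv_0_lt_compat, pow_lt).
      replace (2 * (/ (2 * INR j + 1) * / INR (S (N - j)))) with
        (/ (2 * INR j + 1) * (2 * / INR (S (N - j)))) by ring.
      apply Rmult_le_compat; [left; now apply Rinv_0_lt_compat, pow_lt | apply Rabs_pos | |].
      * apply Rinv_le_contravar; [exact O|].
        rewrite <- (pow_1 (2 * INR j + 1)) at 1. pose proof (pos_INR j).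
        apply Rle_pow; [lra|lia].
      * apply Rle_trans with (1 := Rabs_triang _ _).
        (* Since [N - j <= N + 1 <= N + j + 1], each end moves the alternating sum by at most
           [1 / (N - j + 1)]. *)
        pose proof (harm_alt_dist (S N) (N + j + 1) ltac:(lia)) as B1.
        pose proof (harm_alt_dist (N - j) (S N) ltac:(lia)) as B2.
        rewrite (Rabs_minus_sym (h (N - j)%nat)).
        assert (/ INR (S (S N)) <= / INR (S (N - j))).
        { apply Rinv_le_contravar; [apply lt_0_INR; lia | apply le_INR; lia]. }
        unfold h. lra.
Qed.

(** Exchange of summation: for fixed [j], [k] runs from [j + 1] to [N + 1], and the sum of
    [(-1) ^ (k + 1) / k] over this range is [harm (-1) j - harm (-1) (S N)]. *)
Lemma partial_sum_harm (m N : nat) :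
  sum_n_m (fun k : nat =>
    sum_n_m (fun j : nat =>
      (-1) ^ (j + k + 1) / ((2 * INR j + 1) ^ m * INR k)) 0 (k - 1)) 1 (S N) =
  sum_f_R0 (fun j => (-1) ^ j * / (2 * INR j + 1) ^ m * (harm (-1) j - harm (-1) (S N))) N.
Proof.
  induction N as [|N IH].
  - rewrite sum_n_n. simpl Nat.sub. rewrite sum_n_n, harm_S. simpl.
    rewrite !harm_0, Rmult_0_r, Rplus_0_l, pow1. field.
  - rewrite sum_n_Sm by lia. rewrite IH. rewrite tech5.
    replace (S (S N) - 1)%nat with (S N) by lia.
    change (sum_n_m ?f 0 (S N)) with (sum_n f (S N)). rewrite sum_n_Reals.
    change plus with Rplus.
    rewrite tech5, <- Rplus_assoc, <- sum_plus.
    rewrite (harm_S _ (S N)).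
    f_equal.
    + apply sum_eq; intros j _. rewrite !pow_add. simpl ((-1) ^ 1).
      unfold Rdiv. rewrite Rinv_mult. ring.
    + rewrite !pow_add. simpl ((-1) ^ 1). unfold Rdiv. rewrite Rinv_mult. ring.
Qed.

(** * Bernoulli numbers and sums over odd integers *)

(** Outside the disk of convergence the terms do not tend to [0]. *)
Lemma CV_radius_ge_of_is_pseries (a : nat -> R) (x l : R) :
  is_pseries a x l -> Rbar_le (Rabs x) (CV_radius a).
Proof.
  intros H. apply Rbar_not_lt_le. intros Hlt.
  apply (CV_disk_outside a x Hlt). apply ex_series_lim_0.
  exists l. now apply is_pseries_R.
Qed.

Lemma is_pseries_coef_unique (a b : nat -> R) (f : R -> R) (rho : R) :
  0 < rho ->
  (forall t, Rabs t < rho -> is_pseries a t (f t)) ->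
  (forall t, Rabs t < rho -> is_pseries b t (f t)) ->
  forall n, a n = b n.
Proof.
  intros Hr Ha Hb n.
  assert (Hrad : forall u, (forall t, Rabs t < rho -> is_pseries u t (f t)) ->
    Rbar_lt 0 (CV_radius u)).
  { intros u Hu. apply Rbar_lt_le_trans with (Finite (Rabs (rho / 2))).
    - simpl. apply Rabs_pos_lt. lra.
    - apply CV_radius_ge_of_is_pseries with (f (rho / 2)). apply Hu.
      rewrite Rabs_pos_eq; lra. }
  apply PSeries_ext_recip; [now apply Hrad | now apply Hrad |].
  exists (mkposreal rho Hr). intros t Ht.
  change (Rabs (t - 0) < rho) in Ht. rewrite Rminus_0_r in Ht.
  now rewrite (is_pseries_unique _ _ _ (Ha t Ht)), (is_pseries_unique _ _ _ (Hb t Ht)).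
Qed.

Definition delta0 (n : nat) : R := if Nat.eqb n 0 then 1 else 0.

Lemma is_pseries_delta0 (t : R) : is_pseries delta0 t 1.
Proof.
  apply is_pseries_R.
  change (is_lim_seq (sum_n (fun k => delta0 k * t ^ k)) 1).
  apply is_lim_seq_ext with (fun _ => 1); [|apply is_lim_seq_const].
  intros n. rewrite sum_n_Reals. induction n as [|n IH].
  - unfold delta0; simpl; ring.
  - rewrite tech5, <- IH. unfold delta0; simpl; ring.
Qed.

Definition tanh_half (t : R) : R := (exp t - 1) / (exp t + 1).

(** Taylor coefficients of [tanh (t/2) = 1 - 2 / (e^t + 1)]. The index [S n] comes from dividing the
    series of [- 2 t / (e^t + 1)] by [t]. *)
Definition tanh_coef (B : nat -> R) (n : nat) : R :=
  delta0 n + 2 * (2 ^ S n - 1) * (B (S n) / INR (fact (S n))).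

(* [1 / (e^t + 1) = 1 / (e^t - 1) - 2 / (e^(2t) - 1)]. *)
Lemma is_pseries_tanh_half_punctured (B : nat -> R) : is_bernoulli B ->
  exists rho, 0 < rho /\
    forall t, 0 < Rabs t < rho -> is_pseries (tanh_coef B) t (tanh_half t).
Proof.
  (* The radius is halved because the Bernoulli series is evaluated at [2 t] as well. *)
  intros [r [Hr HB]]. exists (r / 2). split; [lra|]. intros t Ht.
  set (b := fun n => B n / INR (fact n)) in *.
  assert (H1 : is_series (fun k => b k * t ^ k) (t / (exp t - 1))).
  { apply is_pseries_R, HB. lra. }
  assert (H2 : is_series (fun k => b k * (2 * t) ^ k) (2 * t / (exp (2 * t) - 1))).
  { apply is_pseries_R, HB. rewrite Rabs_mult, (Rabs_pos_eq 2); lra. }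
  assert (Ht0 : t <> 0) by (intros ->; rewrite Rabs_R0 in Ht; lra).
  pose proof (exp_pos t) as Hexp.
  assert (Hexp1 : exp t - 1 <> 0).
  { intros E. apply Ht0, exp_inv. rewrite exp_0. lra. }
  assert (H3 : is_pseries (fun k => 2 * (2 ^ k - 1) * b k) t (- 2 * t / (exp t + 1))).
  { apply is_pseries_R.
    replace (- 2 * t / (exp t + 1)) with
      (scal 2 (minus (2 * t / (exp (2 * t) - 1)) (t / (exp t - 1)))).
    - apply is_series_ext with (fun k => scal 2 (minus (b k * (2 * t) ^ k) (b k * t ^ k))).
      + intros k. rewrite Rpow_mult_distr. unfold scal, minus, plus, opp; simpl.
        unfold mult; simpl. ring.
      + apply (is_series_scal 2 (fun k => minus (b k * (2 * t) ^ k) (b k * t ^ k))).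
        apply (is_series_minus (fun k => b k * (2 * t) ^ k) (fun k => b k * t ^ k) _ _ H2 H1).
    - unfold scal, minus, plus, opp; simpl. unfold mult; simpl.
      replace (2 * t) with (t + t) by ring. rewrite exp_plus.
      field. repeat split; try lra.
      replace (exp t * exp t - 1) with ((exp t - 1) * (exp t + 1)) by ring.
      apply Rmult_integral_contrapositive; split; lra. }
  (* Division by [t] loses nothing: the constant coefficient carries the factor [2 ^ 0 - 1 = 0]. *)
  apply (is_pseries_decr_1 _ _ (/ t)) in H3; [|apply Rinv_l; exact Ht0].
  replace (tanh_half t) with (plus 1 (scal (/ t) (plus (- 2 * t / (exp t + 1))
    (opp (2 * (2 ^ 0 - 1) * b 0%nat))))).
  - apply (is_pseries_plus _ _ _ _ _ (is_pseries_delta0 t) H3).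
  - unfold tanh_half, scal, plus, opp; simpl. unfold mult; simpl. field. lra.
Qed.

Lemma is_derive_tanh_half (t : R) :
  is_derive tanh_half t (/ 2 * (1 - tanh_half t * tanh_half t)).
Proof.
  pose proof (exp_pos t). unfold tanh_half. auto_derive; [lra|]. field. lra.
Qed.

(** The point [t = 0] is filled in by continuity: the power series and [tanh_half] agree on a
    punctured neighbourhood and are both continuous at [0]. *)
Lemma is_pseries_tanh_half (B : nat -> R) : is_bernoulli B ->
  exists rho, 0 < rho /\
    forall t, Rabs t < rho -> is_pseries (tanh_coef B) t (tanh_half t).
Proof.
  intros HB. destruct (is_pseries_tanh_half_punctured B HB) as [rho [Hr H]].
  exists rho. split; [exact Hr|]. set (c := tanh_coef B) in *.
  assert (Hrad : Rbar_lt (Rabs 0) (CV_radius c)).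
  { apply Rbar_lt_le_trans with (Finite (Rabs (rho / 2))).
    - simpl. rewrite Rabs_R0. apply Rabs_pos_lt. lra.
    - apply CV_radius_ge_of_is_pseries with (tanh_half (rho / 2)). apply H.
      rewrite Rabs_pos_eq; lra. }
  assert (H0 : c 0%nat = tanh_half 0).
  { rewrite <- PSeries_0.
    assert (L1 : is_lim (PSeries c) 0 (PSeries c 0)).
    { apply is_lim_continuity, PSeries_continuity, Hrad. }
    assert (L2 : is_lim (PSeries c) 0 (tanh_half 0)).
    { apply is_lim_ext_loc with tanh_half.
      - exists (mkposreal rho Hr). intros t Ht Ht0. symmetry.
        change (Rabs (t - 0) < rho) in Ht. rewrite Rminus_0_r in Ht.
        apply is_pseries_unique, H. split; [now apply Rabs_pos_lt | exact Ht].
      - apply is_lim_continuity, derivable_continuous_pt.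
        eexists. apply is_derive_Reals, is_derive_tanh_half. }
    apply is_lim_unique in L1. apply is_lim_unique in L2. rewrite L1 in L2.
    now injection L2. }
  intros t Ht. destruct (Req_dec t 0) as [->|Ht0].
  - rewrite <- H0, <- PSeries_0. apply PSeries_correct, CV_radius_inside, Hrad.
  - apply H. split; [now apply Rabs_pos_lt | exact Ht].
Qed.

(* [y t = tanh (t / 2)] satisfies [y' = (1 - y^2) / 2]. *)
Lemma tanh_coef_rec (B : nat -> R) : is_bernoulli B -> forall n,
  INR (S n) * tanh_coef B (S n) =
  / 2 * delta0 n - / 2 * sum_f_R0 (fun k => tanh_coef B k * tanh_coef B (n - k)) n.
Proof.
  intros HB. destruct (is_pseries_tanh_half B HB) as [rho [Hr H]].
  set (c := tanh_coef B) in *. set (rho' := rho / 2).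
  assert (Hrad : forall t, Rabs t < rho' -> Rbar_lt (Rabs t) (CV_radius c)).
  { intros t Ht. apply Rbar_lt_le_trans with (Finite (Rabs rho')).
    - simpl. rewrite (Rabs_pos_eq rho'); unfold rho' in *; lra.
    - apply CV_radius_ge_of_is_pseries with (tanh_half rho'). apply H.
      unfold rho'. rewrite Rabs_pos_eq; lra. }
  (* Both sides are coefficients of the power series of [y']: one by termwise differentiation, the
     other by a Cauchy product in [(1 - y^2) / 2]. *)
  assert (E : forall n, PS_derive c n =
    PS_plus (PS_scal (/ 2) delta0) (PS_scal (- / 2) (PS_mult c c)) n).
  { apply is_pseries_coef_unique with (fun t => / 2 * (1 - tanh_half t * tanh_half t)) rho'.
    - unfold rho'; lra.
    - intros t Ht. replace (/ 2 * (1 - tanh_half t * tanh_half t)) with (Derive (PSeries c) t).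
      + apply is_pseries_derive, Hrad, Ht.
      + apply is_derive_unique. apply is_derive_ext_loc with (2 := is_derive_tanh_half t).
        assert (Hd : 0 < rho - Rabs t) by (unfold rho' in *; lra).
        exists (mkposreal _ Hd). simpl. intros u Hu. symmetry. apply is_pseries_unique, H.
        change (Rabs (u - t) < rho - Rabs t) in Hu.
        pose proof (Rabs_triang (u - t) t) as T.
        unfold Rminus in T. rewrite Rplus_assoc, Rplus_opp_l, Rplus_0_r in T.
        unfold Rminus in Hu. lra.
    - intros t Ht.
      replace (/ 2 * (1 - tanh_half t * tanh_half t)) with
        (/ 2 * 1 + - / 2 * (tanh_half t * tanh_half t)) by ring.
      apply (is_pseries_plus (PS_scal (/ 2) delta0) (PS_scal (- / 2) (PS_mult c c)) t
        (/ 2 * 1) (- / 2 * (tanh_half t * tanh_half t)));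
        apply (is_pseries_scal (V := R_NormedModule)); try apply Rmult_comm.
      + apply is_pseries_delta0.
      + assert (Rabs t < rho) by (unfold rho' in *; lra).
        apply is_pseries_mult; auto. }
  intros n. specialize (E n). unfold PS_derive in E. rewrite E.
  unfold PS_plus, PS_scal, PS_mult, plus, scal; simpl. unfold mult; simpl. ring.
Qed.

(** The constant coefficient is [tanh 0 = 0]. At odd [n] every product in the recursion has one
    factor of even index at most [n], which vanishes by induction. *)
Lemma tanh_coef_even (B : nat -> R) : is_bernoulli B -> forall k, tanh_coef B (2 * k) = 0.
Proof.
  intros HB k. induction k as [k IH] using lt_wf_ind. destruct k as [|k].
  - destruct (is_pseries_tanh_half B HB) as [rho [Hr H]].
    specialize (H 0). rewrite Rabs_R0 in H. apply H, is_pseries_unique in Hr.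
    rewrite Nat.mul_0_r, <- PSeries_0, Hr. unfold tanh_half. rewrite exp_0. lra.
  - replace (2 * S k)%nat with (S (2 * k + 1)) by lia.
    assert (Hn : INR (S (2 * k + 1)) <> 0) by (apply not_0_INR; lia).
    apply (Rmult_eq_reg_l _ _ _) with (2 := Hn). rewrite Rmult_0_r, tanh_coef_rec by assumption.
    rewrite (sum_eq _ (fun _ => 0)).
    + rewrite sum_cte. unfold delta0. rewrite Nat.add_1_r. simpl Nat.eqb. cbv iota. ring.
    + intros i Hi. destruct (Nat.Even_or_Odd i) as [[q ->]|[q ->]].
      * rewrite IH by lia. ring.
      * replace (2 * k + 1 - (2 * q + 1))%nat with (2 * (k - q))%nat by lia.
        rewrite IH by lia. ring.
Qed.

Lemma sum_f_R0_odd_support (f : nat -> R) (p : nat) :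
  (forall k, f (2 * k)%nat = 0) ->
  sum_f_R0 f (2 * p) = sum1 (fun h => f (2 * h - 1)%nat) p.
Proof.
  intros Hf. induction p as [|p IH].
  - rewrite sum1_0. apply (Hf 0%nat).
  - rewrite sum1_S, <- IH. replace (2 * S p)%nat with (S (S (2 * p))) by lia.
    rewrite !tech5. replace (S (S (2 * p))) with (2 * S p)%nat by lia.
    rewrite Hf. replace (2 * S p - 1)%nat with (S (2 * p)) by lia. ring.
Qed.

(* The value [(1 - 2^(-2h)) zeta(2h)]. *)
Definition odd_zeta (B : nat -> R) (h : nat) : R :=
  - ((-1) ^ h * PI ^ (2 * h) * (2 ^ (2 * h) - 1) / INR (fact (2 * h)) * B (2 * h)%nat) / 2.

Lemma odd_zeta_tanh_coef (B : nat -> R) (h : nat) : (1 <= h)%nat ->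
  odd_zeta B h = - (-1) ^ h * PI ^ (2 * h) / 4 * tanh_coef B (2 * h - 1).
Proof.
  intros Hh. unfold odd_zeta, tanh_coef, delta0.
  replace (S (2 * h - 1)) with (2 * h)%nat by lia.
  destruct (Nat.eqb_spec (2 * h - 1) 0); [lia|].
  field. apply INR_fact_neq_0.
Qed.

(** After the scaling of [odd_zeta_tanh_coef], the recursion of [tanh_coef] at [n = 2p], restricted
    to odd indices, is the one required by [odd_sum_even_lim]. *)
Lemma odd_zeta_lim (B : nat -> R) (h : nat) : is_bernoulli B -> (1 <= h)%nat ->
  is_lim_seq (odd_sum 1 (2 * h)) (odd_zeta B h).
Proof.
  intros HB. revert h. apply odd_sum_even_lim.
  (* The recursion at [n = 0] gives [tanh_coef B 1 = 1/2], hence the value [PI^2 / 8]. *)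
  - rewrite odd_zeta_tanh_coef by lia.
    pose proof (tanh_coef_rec B HB 0) as R0.
    pose proof (tanh_coef_even B HB 0) as C0.
    simpl in R0, C0. rewrite C0 in R0. unfold delta0 in R0; simpl in R0.
    change (2 * 1 - 1)%nat with 1%nat. replace (tanh_coef B 1) with (/ 2) by lra.
    simpl. field.
  - intros p Hp. rewrite odd_zeta_tanh_coef by lia.
    replace (2 * S p - 1)%nat with (S (2 * p)) by lia.
    pose proof (tanh_coef_rec B HB (2 * p)) as R0.
    assert (D : delta0 (2 * p) = 0).
    { unfold delta0. destruct (Nat.eqb_spec (2 * p) 0); [lia | reflexivity]. }
    rewrite D, sum_f_R0_odd_support in R0
      by (intros k; rewrite tanh_coef_even by assumption; ring).
    rewrite (sum1_ext (fun h => odd_zeta B h * odd_zeta B (S p - h)) (fun h =>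
      - (-1) ^ p * PI ^ (2 * S p) / 16 *
      (tanh_coef B (2 * h - 1) * tanh_coef B (2 * p - (2 * h - 1))))).
    + rewrite sum1_mult_l. replace (2 * p + 1)%nat with (S (2 * p)) by lia.
      set (X := sum1 _ p) in *. simpl ((-1) ^ S p).
      transitivity ((-1) ^ p * PI ^ (2 * S p) / 4 * (INR (S (2 * p)) * tanh_coef B (S (2 * p)))).
      * unfold Rdiv; ring.
      * rewrite R0. field.
    + intros h Hh. rewrite !odd_zeta_tanh_coef by lia.
      replace (2 * (S p - h) - 1)%nat with (2 * p - (2 * h - 1))%nat by lia.
      assert (P : PI ^ (2 * S p) = PI ^ (2 * h) * PI ^ (2 * (S p - h))).
      { rewrite <- pow_add. f_equal; lia. }
      assert (Q : - (-1) ^ p = (-1) ^ h * (-1) ^ (S p - h)).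
      { rewrite <- pow_add. replace (h + (S p - h))%nat with (S p) by lia. simpl; ring. }
      rewrite P, Q. field.
Qed.

Theorem theorem1 (m : nat) (hpos : (0 < m)%nat) (hodd : Nat.Odd m)
    (B : nat -> R) (hB : is_bernoulli B) :
  is_lim_seq
    (fun K : nat =>
       sum_n_m (fun k : nat =>
         sum_n_m (fun j : nat =>
           (-1) ^ (j + k + 1) / ((2 * INR j + 1) ^ m * INR k)) 0 (k - 1)) 1 K)
    (Finite
      (INR m * L_chi_m4 (m + 1) +
       sum_n_m (fun h : nat =>
         (-1) ^ h * PI ^ (2 * h) * (2 ^ (2 * h) - 1) / INR (fact (2 * h))
         * B (2 * h)%nat * L_chi_m4 (m - 2 * h + 1)) 1 ((m - 1) / 2))).
Proof.
  destruct hodd as [p ->].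
  replace ((2 * p + 1 - 1) / 2)%nat with p
    by (rewrite Nat.add_sub, Nat.mul_comm, Nat.div_mul; lia).
  apply is_lim_seq_incr_1.
  eapply is_lim_seq_ext; [intros N; symmetry; apply partial_sum_harm|].
  match goal with |- is_lim_seq _ (Finite (?a + sum_n_m ?f 1 p)) =>
    replace (a + sum_n_m f 1 p) with
      (INR (2 * p + 1) * L_chi_m4 (2 * p + 2)
      - 2 * sum1 (fun h => odd_zeta B h * L_chi_m4 (2 * p + 2 - 2 * h)) p) end.
  - apply alternating_double_sum_lim. intros h Hh. now apply odd_zeta_lim.
  - change (sum_n_m ?f 1 p) with (sum1 f p).
    replace (2 * p + 1 + 1)%nat with (2 * p + 2)%nat by lia.
    (* The coefficient of each L-value in the theorem is [- 2 * odd_zeta B h]. *)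
    unfold Rminus. f_equal. rewrite Ropp_mult_distr_l, <- sum1_mult_l.
    apply sum1_ext. intros h Hh.
    replace (2 * p + 1 - 2 * h + 1)%nat with (2 * p + 2 - 2 * h)%nat by lia.
    unfold odd_zeta. field. apply INR_fact_neq_0.
Qed.
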